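(* Assume the setting described in the context, with bounded measurable drifts $b_+,b_-$, and suppose there are constants $r_+>0$, $r_->0$ such that for all $x\in\mathbb R$ $$b_+(x)\ge r_+,\qquad b_-(x)\ge -r_-,\qquad\text{and}\qquad \frac{r_+}{\lambda_+}>\frac{r_-}{\lambda_-}.$$ Then $X_t\to+\infty$ almost surely as $t\to\infty$. Moreover, there is a constant $c_0>0$ such that $$\liminf_{t\to\infty}\frac{X_t}{t}\ge c_0\quad\text{a.s.},$$ and there is a constant $c_0>0$ such that for every $\epsilon>0$ there exist $\kappa\in(0,1)$ and $t_0=t_0(\kappa,\epsilon)$ with $$\mathbb P_x\Big(\frac{X_t-x}{t}-c_0<-\epsilon\Big)<\kappa^{t}\qquad\text{for all } t\ge t_0 .$$
   Context: Let $(\Omega,\mathcal F,(\mathcal F_t),\mathbb P)$ be a filtered probability space carrying a one-dimensional standard Wiener process $W$ and, independent of $W$, a continuous-time Markov chain $Z=(Z_t)_{t\ge0}$ with right-continuous paths taking values in $\{0,1\}$; $\mathcal F_t$ is generated by $W$ and $Z$ up to time $t$. State $1$ is the ''$+$'' regime and state $0$ the ''$-$'' regime: the chain leaves state $1$ with constant rate $\lambda_+>0$ and leaves state $0$ with constant rate $\lambda_->0$ (so sojourn times are independent exponential variables with these parameters). Let $b_+,b_-:\mathbb R\to\mathbb R$ be Borel measurable with $\sup_x|b_\pm(x)|<\infty$, and set $b(x,1)=b_+(x)$, $b(x,0)=b_-(x)$. The process $X$ is the unique strong solution of $$dX_t=b(X_t,Z_t)\,dt+dW_t,\qquad X_0=x\in\mathbb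 R,\ Z_0=z\in\{0,1\};$$ $\mathbb P_x,\mathbb E_x$ denote probability and expectation for this process started at $X_0=x$. *)

(* Defs.v *)
From HB Require Import structures.
From mathcomp Require Import all_boot all_order all_algebra.
From mathcomp Require Import all_classical all_reals all_analysis.
Set Implicit Arguments. Unset Strict Implicit. Unset Printing Implicit Defensive.
Import Order.TTheory GRing.Theory Num.Theory.
Import numFieldNormedType.Exports.
Local Open Scope classical_set_scope.
Local Open Scope ring_scope.

(* Regime: true = "+" (state 1), false = "-" (state 0). *)
Definition drift {R : realType} (bp bm : R -> R) (x : R) (s : bool) : R :=
  if s then bp x else bm x.

Definition leave_rate {R : realType} (lp lm : R) (s : bool) : R :=
  if s then lp else lm.

(* Regime during the k-th sojourn (k = 0, 1, ...) when Z_0 = z: regimes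
   alternate since the chain has two states. *)
Definition sojourn_state (z : bool) (k : nat) : bool :=
  if odd k then ~~ z else z.

Definition jump_time {R : realType} (Omega : Type) (tau : nat -> Omega -> R)
  (k : nat) (w : Omega) : R := \sum_(j < k) tau j w.

Definition mutual_indep {d : measure_display} {Omega : measurableType d}
  {R : realType} (P : probability Omega R) (n : nat) (Y : 'I_n -> Omega -> R) :=
  forall B : 'I_n -> set R, (forall i, measurable (B i)) ->
    P (\bigcap_(i in [set: 'I_n]) (Y i @^-1` B i)) =
    (\prod_(i < n) P (Y i @^-1` B i))%E.

(* W is a standard Wiener process (W_0 = 0, continuous paths, independent
   centred Gaussian increments of variance t - s) and, independently of W,
   tau_0, tau_1, ... are independent sojourn times, tau_k exponential with
   the leaving rate of the regime occupied during the k-th sojourn.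
   Stated through the joint law of any finite family of increments of W
   and of sojourn times. *)
Definition wiener_and_sojourns {d : measure_display} {Omega : measurableType d}
  {R : realType} (P : probability Omega R) (W : R -> Omega -> R)
  (tau : nat -> Omega -> R) (z : bool) (lp lm : R) : Prop :=
  [/\ (forall w, W 0 w = 0),
      (forall w, continuous (fun t => W t w)),
      (forall t, measurable_fun setT (W t)),
      (forall k, measurable_fun setT (tau k)) &
      forall (n m : nat) (t : nat -> R), t 0%N = 0 ->
        (forall i, (i < n)%N -> t i < t i.+1) ->
        [/\ mutual_indep P (fun i : 'I_(n + m) =>
               match fintype.split i with
               | inl j => fun w => W (t j.+1) w - W (t j) w
               | inr k => tau k
               end),
            (forall (j : 'I_n) (B : set R), measurable B ->
               P ((fun w => W (t j.+1) w - W (t j) w) @^-1` B) =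
               normal_prob 0 (Num.sqrt (t j.+1 - t j)) B) &
            (forall (k : 'I_m) (B : set R), measurable B ->
               P (tau k @^-1` B) =
               exponential_prob (leave_rate lp lm (sojourn_state z k)) B)]].

Definition chain_from_sojourns {R : realType} (Omega : Type)
  (tau : nat -> Omega -> R) (z : bool) (Z : R -> Omega -> bool) : Prop :=
  forall w k t, jump_time tau k w <= t < jump_time tau k.+1 w ->
    Z t w = sojourn_state z k.

Definition solves_sde {d : measure_display} {Omega : measurableType d}
  {R : realType} (P : probability Omega R) (bp bm : R -> R)
  (W : R -> Omega -> R) (Z : R -> Omega -> bool) (X : R -> Omega -> R)
  (x : R) : Prop :=
  (forall t, measurable_fun setT (X t)) /\
  {ae P, forall w : Omega, forall t : R, 0 <= t ->
     measurable_fun `[0, t] (fun s : R => drift bp bm (X s w) (Z s w)) /\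
     X t w = x + Rintegral lebesgue_measure `[0, t]
                   (fun s : R => drift bp bm (X s w) (Z s w)) + W t w}.

(* Main.v *)
Require Import Defs.
From HB Require Import structures.
From mathcomp Require Import all_boot all_order all_algebra.
From mathcomp Require Import all_classical all_reals all_analysis.
From mathcomp Require Import measurable_realfun ring lra.
Set Implicit Arguments.
Unset Strict Implicit.
Unset Printing Implicit Defensive.
Import Order.TTheory GRing.Theory Num.Theory.
Import numFieldNormedType.Exports.
Local Open Scope classical_set_scope.
Local Open Scope ring_scope.

(* Take a small slack c > 0 out of both drift bounds. Along a path, the drift
   integral minus c t is at least the broken line of slope rp - c in regime +
   and - (rm + c) in regime -, whose value S_k at the k-th jump time is a sum
   of independent terms. Since rm / lm < rp / lp, an exponential tilt makes the
   Laplace transform of two consecutive terms smaller than 1, and Chernoff's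
   bound gives P(S_k <= del k) <= C exp(- b k). If S_k > del k for all k >= m,
   then the chain does not explode and the drift integral is at least c t for
   all t past the m-th jump; with m proportional to t, the m-th jump occurs
   before t up to an exponentially small probability. Gaussian tails bound
   P(|W_t| >= c t / 2), and Borel-Cantelli together with dyadic chaining gives
   W_t = o(t) almost surely, so that c0 = c / 2 works throughout. *)

(** * Expectations and moment generating functions *)

Lemma measurable_preimageT d d' (T : measurableType d) (U : measurableType d')
    (f : T -> U) (B : set U) :
  measurable_fun setT f -> measurable B -> measurable (f @^-1` B).
Proof. by move=> mf mB; rewrite -[X in measurable X]setTI; exact: mf. Qed.

Lemma measurable_set_bool d (T : measurableType d) (b : T -> bool) :
  measurable_fun setT b -> measurable [set x | b x].
Proof. by move=> mb; exact: (@measurable_preimageT _ _ _ _ b [set true]). Qed.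

Lemma chernoff_ge d (T : measurableType d) (R : realType)
    (P : probability T R) (X : T -> R) (r a : R) :
  measurable_fun setT X -> 0 < r ->
  (P [set w | a <= X w]%R <= 'M_P X r * (expR (- (r * a)))%:E)%E.
Proof.
move=> mX; exact: (chernoff (mfun_Sub (mem_set mX) : {RV P >-> R})).
Qed.

Lemma chernoff_le d (T : measurableType d) (R : realType)
    (P : probability T R) (X : T -> R) (r a : R) :
  measurable_fun setT X -> 0 < r ->
  (P [set w | X w <= a]%R <= 'M_P X (- r) * (expR (r * a))%:E)%E.
Proof.
move=> mX r_gt0.
have mNX : measurable_fun setT (- X) by exact: measurableT_comp.
have := chernoff_ge P (- a) mNX r_gt0.
rewrite mulrN opprK; congr (P _ <= 'E_P[_] * _)%E.
- by apply: eq_set => w /=; rewrite fctE lerN2.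
- by apply/funext => w /=; rewrite mulNr mulrN.
Qed.

Import HBNNSimple.

Section integral_comp.
Local Open Scope ereal_scope.
Context (R : realType) d (T : measurableType d) (m : {measure set T -> \bar R}).
Variables F Y : T -> R.
Hypothesis mF : measurable_fun setT F.
Hypothesis F_ge0 : forall x, (0 <= F x)%R.
Hypothesis mY : measurable_fun setT Y.

Lemma ge0_integral_comp_nnsfun (h : {nnsfun R >-> R}) :
  \int[m]_x (F x * h (Y x))%:E =
  \sum_(y \in range h) (y%:E * \int[m]_x (F x * \1_(h @^-1` [set y]) (Y x))%:E).
Proof.
have mI y : measurable_fun setT
    (fun x => (F x * \1_(h @^-1` [set y]) (Y x))%:E).
  apply/measurable_EFinP; apply: measurable_funM => //.
  exact: measurableT_comp.
transitivity (\int[m]_x \sum_(y \in range h)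
    (y%:E * (F x * \1_(h @^-1` [set y]) (Y x))%:E)).
  apply: eq_integral => x _; rewrite (fimfunE h) EFinM -fsumEFin//.
  rewrite ge0_mule_fsumr; last first.
    by move=> y; rewrite EFinM; exact: nnfun_muleindic_ge0.
  by apply: eq_fsbigr => y _; rewrite !EFinM muleCA.
rewrite ge0_integral_fsum//.
- apply: eq_fsbigr => y /set_mem[x _ <-].
  rewrite ge0_integralZl ?lee_fin//.
  by move=> t _; rewrite lee_fin mulr_ge0.
- by move=> y; apply: measurable_funeM.
- move=> y x _.
  by rewrite EFinM muleCA mule_ge0 ?lee_fin//; exact: nnfun_muleindic_ge0.
Qed.

Lemma ge0_integral_comp_approx (f : R -> R)
    (mf : measurable_fun setT (EFin \o f)) : (forall y, 0 <= f y)%R ->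
  \int[m]_x (F x * f (Y x))%:E =
  limn (fun n => \int[m]_x (F x * nnsfun_approx measurableT mf n (Y x))%:E).
Proof.
move=> f_ge0; rewrite -monotone_convergence//.
- apply: eq_integral => x _; apply/esym/cvg_lim => //.
  under eq_fun do rewrite EFinM.
  rewrite EFinM; apply: cvgeZl => //.
  by apply: (cvg_nnsfun_approx measurableT mf) => // y _; rewrite lee_fin.
- move=> n; apply/measurable_EFinP; apply: measurable_funM => //.
  exact: measurableT_comp.
- by move=> n x _; rewrite lee_fin mulr_ge0.
- move=> x _ a b ab; rewrite lee_fin ler_wpM2l//.
  by have /lefP := nd_nnsfun_approx measurableT mf ab; exact.
Qed.

End integral_comp.

Lemma ge0_eq_integral_comp (R : realType) d1 d2 (T1 : measurableType d1)
    (T2 : measurableType d2) (m1 : {measure set T1 -> \bar R})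
    (m2 : {measure set T2 -> \bar R}) (F1 Y1 : T1 -> R) (F2 Y2 : T2 -> R)
    (f : R -> R) :
  measurable_fun setT F1 -> (forall x, 0 <= F1 x) -> measurable_fun setT Y1 ->
  measurable_fun setT F2 -> (forall x, 0 <= F2 x) -> measurable_fun setT Y2 ->
  (forall B, measurable B ->
    \int[m1]_x (F1 x * \1_B (Y1 x))%:E =
    \int[m2]_x (F2 x * \1_B (Y2 x))%:E)%E ->
  measurable_fun setT f -> (forall y, 0 <= f y) ->
  (\int[m1]_x (F1 x * f (Y1 x))%:E = \int[m2]_x (F2 x * f (Y2 x))%:E)%E.
Proof.
move=> mF1 F1_ge0 mY1 mF2 F2_ge0 mY2 eq_indic /measurable_EFinP mf f_ge0.
rewrite !(ge0_integral_comp_approx _ _ _ _ mf)//; congr (limn _).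
apply/funext => n; rewrite !ge0_integral_comp_nnsfun//.
by apply: eq_fsbigr => y _; rewrite eq_indic.
Qed.

Lemma expectation_indic_comp d (T : measurableType d) (R : realType)
    (P : probability T R) (Y : T -> R) (B : set R) :
  measurable_fun setT Y -> measurable B ->
  'E_P[\1_B \o Y]%E = P (Y @^-1` B).
Proof.
by move=> mY mB; rewrite -expectation_indic//; exact: measurable_preimageT.
Qed.

Lemma ge0_expectation_density d (T : measurableType d) (R : realType)
    (P : probability T R) (Y p f : _ -> R) :
  measurable_fun [set: T] Y ->
  measurable_fun [set: R] p -> (forall y, 0 <= p y) ->
  (forall B, measurable B ->
    P (Y @^-1` B) = \int[lebesgue_measure]_(y in B) (p y)%:E)%E ->
  measurable_fun [set: R] f -> (forall y, 0 <= f y) ->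
  ('E_P[f \o Y] = \int[lebesgue_measure]_y (p y * f y)%:E)%E.
Proof.
move=> mY mp p_ge0 Yp mf f_ge0; rewrite unlock.
transitivity (\int[P]_w (cst 1 w * f (Y w))%:E)%E.
  by apply: eq_integral => w _; rewrite mul1r.
apply: (@ge0_eq_integral_comp _ _ _ _ _ P lebesgue_measure (cst 1) Y p id)
  => // B mB.
transitivity 'E_P[\1_B \o Y]%E.
  by rewrite unlock; apply: eq_integral => w _; rewrite mul1r.
rewrite expectation_indic_comp// Yp// [LHS]integral_mkcond epatch_indic.
by apply: eq_integral => y _; rewrite EFinM.
Qed.

Lemma exponential_mgf d (T : measurableType d) (R : realType)
    (P : probability T R) (Y : T -> R) (l th : R) :
  measurable_fun setT Y ->
  (forall B, measurable B -> P (Y @^-1` B) = exponential_prob l B) ->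
  0 < l -> th < l -> ('M_P Y th = (l / (l - th))%:E)%E.
Proof.
move=> mY PY l_gt0 th_l; have lth_gt0 : 0 < l - th by rewrite subr_gt0.
rewrite /mmt_gen_fun (@ge0_expectation_density _ _ _ _ Y (exponential_pdf l)
  (fun y => expR (y * th)))//; first last.
- by apply: measurableT_comp => //; exact: measurable_funM.
- by move=> y; exact/exponential_pdf_ge0/ltW.
- exact: measurable_exponential_pdf.
transitivity (\int[lebesgue_measure]_y
    ((l / (l - th))%:E * (exponential_pdf (l - th) y)%:E))%E.
  apply: eq_integral => y _; rewrite -EFinM; congr EFin.
  have [y_ge0|y_lt0] := leP 0 y; last first.
    by rewrite !lt0_exponential_pdf// mul0r mulr0.
  rewrite !exponential_pdfE// mulrA divfK ?gt_eqF// -mulrA -expRD.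
  by congr (_ * expR _); ring.
rewrite ge0_integralZl//.
- by rewrite integral_exponential_pdf// mule1.
- by apply/measurable_EFinP; exact: measurable_exponential_pdf.
- by move=> y _; rewrite lee_fin; exact/exponential_pdf_ge0/ltW.
- by rewrite lee_fin divr_ge0// ltW.
Qed.

Lemma exponential_ae_ge0 d (T : measurableType d) (R : realType)
    (P : probability T R) (Y : T -> R) (l : R) :
  measurable_fun setT Y ->
  (forall B, measurable B -> P (Y @^-1` B) = exponential_prob l B) ->
  {ae P, forall w, 0 <= Y w}.
Proof.
move=> mY PY; exists (Y @^-1` `]-oo, 0[); split.
- exact: measurable_preimageT.
- rewrite PY// /exponential_prob integral0_eq// => y /=.
  by rewrite in_itv/= => y_lt0; rewrite lt0_exponential_pdf.
- by move=> w /= /negP; rewrite -ltNge in_itv.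
Qed.

Lemma normal_mgf d (T : measurableType d) (R : realType)
    (P : probability T R) (Y : T -> R) (s th : R) :
  measurable_fun setT Y -> s != 0 ->
  (forall B, measurable B -> P (Y @^-1` B) = normal_prob 0 s B) ->
  ('M_P Y th = (expR (s ^+ 2 * th ^+ 2 / 2))%:E)%E.
Proof.
move=> mY s_neq0 PY.
rewrite /mmt_gen_fun (@ge0_expectation_density _ _ _ _ Y (normal_pdf 0 s)
  (fun y => expR (y * th)))//; first last.
- by apply: measurableT_comp => //; exact: measurable_funM.
- exact: normal_pdf_ge0.
- exact: measurable_normal_pdf.
transitivity (\int[lebesgue_measure]_y
    ((expR (s ^+ 2 * th ^+ 2 / 2))%:E * (normal_pdf (s ^+ 2 * th) s y)%:E))%E.
  apply: eq_integral => y _; rewrite -EFinM; congr EFin.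
  rewrite !normal_pdfE//= [RHS]mulrCA -[LHS]mulrA /normal_fun -!expRD.
  by congr (_ * expR _); rewrite -[s ^+ 2 *+ 2]mulr_natr; field.
rewrite ge0_integralZl ?lee_fin ?expR_ge0//.
- by rewrite integral_normal_pdf mule1.
- by apply/measurable_EFinP; exact: measurable_normal_pdf.
- by move=> y _; rewrite lee_fin normal_pdf_ge0.
Qed.

Lemma normal_tail d (T : measurableType d) (R : realType)
    (P : probability T R) (Y : T -> R) (s a : R) :
  measurable_fun setT Y -> s != 0 ->
  (forall B, measurable B -> P (Y @^-1` B) = normal_prob 0 s B) -> 0 < a ->
  (P [set w | a <= `|Y w|]%R <= (2 * expR (- a ^+ 2 / (s ^+ 2 *+ 2)))%:E)%E.
Proof.
move=> mY s_neq0 PY a_gt0; have s2_gt0 : 0 < s ^+ 2 by rewrite exprn_even_gt0.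
have th_gt0 : 0 < a / s ^+ 2 by rewrite divr_gt0.
have exponentE : s ^+ 2 * (a / s ^+ 2) ^+ 2 / 2 - a / s ^+ 2 * a =
    - a ^+ 2 / (s ^+ 2 *+ 2) by field.
have -> : [set w | a <= `|Y w|] = [set w | a <= Y w] `|` [set w | Y w <= - a].
  apply/seteqP; split => w /=; rewrite real_ler_normr ?num_real// lerNr.
    by move/orP.
  by move=> ?; apply/orP.
apply: le_trans (measureU2 P _ _) _.
- by apply: measurable_set_bool; exact: measurable_fun_ler.
- by apply: measurable_set_bool; exact: measurable_fun_ler.
rewrite mulrDl !mul1r EFinD; apply: leeD.
- apply: le_trans (chernoff_ge P a mY th_gt0) _.
  by rewrite (normal_mgf _ mY s_neq0 PY) -EFinM lee_fin -expRD exponentE.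
- apply: le_trans (chernoff_le P (- a) mY th_gt0) _.
  rewrite (normal_mgf _ mY s_neq0 PY) -EFinM lee_fin -expRD sqrrN mulrN.
  by rewrite exponentE.
Qed.

Section mutual_indep_expectation.
Local Open Scope ereal_scope.
Context d (T : measurableType d) (R : realType) (P : probability T R).

Lemma ge0_expectationM_comp (F Z : T -> R) (g : R -> R) (a : R) :
  measurable_fun setT F -> (forall w, 0 <= F w)%R -> measurable_fun setT Z ->
  measurable_fun setT g -> (forall y, 0 <= g y)%R -> (0 <= a)%R ->
  (forall B, measurable B ->
    'E_P[fun w => F w * \1_B (Z w)]%R = a%:E * P (Z @^-1` B)) ->
  'E_P[fun w => F w * g (Z w)]%R = a%:E * 'E_P[g \o Z].
Proof.
move=> mF F_ge0 mZ mg g_ge0 a_ge0 FZ.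
have pull_cst (f : R -> R) : measurable_fun setT f -> (forall y, 0 <= f y)%R ->
    \int[P]_w (cst a w * f (Z w))%:E = a%:E * 'E_P[f \o Z].
  move=> mf f_ge0; under eq_integral do rewrite EFinM.
  rewrite unlock ge0_integralZl_EFin//; first by move=> w _; rewrite lee_fin.
  by apply/measurable_EFinP; exact: measurableT_comp.
rewrite -pull_cst// unlock.
apply: (@ge0_eq_integral_comp R _ _ _ _ P P F Z (cst a) Z g) => // B mB.
rewrite pull_cst//.
by rewrite expectation_indic_comp// -FZ// unlock.
Qed.

Variables (n : nat) (Y : 'I_n -> T -> R).
Hypothesis mY : forall i, measurable_fun setT (Y i).
Hypothesis indepY : mutual_indep P Y.

Lemma mutual_indep_expectation_indic (B : 'I_n -> set R) :
  (forall i, measurable (B i)) ->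
  'E_P[fun w => \prod_(i < n) \1_(B i) (Y i w)]%R =
  \prod_(i < n) 'E_P[\1_(B i) \o Y i].
Proof.
move=> mB; under eq_bigr do rewrite expectation_indic_comp//.
rewrite -indepY// -expectation_indic; last first.
  by apply: fin_bigcap_measurable => // i _; exact: measurable_preimageT.
congr 'E_P[_]; apply/funext => w; rewrite [RHS]indicE.
have [YB|/existsNP[i YB]] := pselect (forall i, B i (Y i w)).
  rewrite mem_set => [|i _]; last exact: YB.
  by rewrite big1// => i _; rewrite indicE mem_set.
rewrite memNset => [|/(_ i Logic.I)//].
by rewrite (bigD1 i)//= indicE memNset// mul0r.
Qed.

Let expectation_prod_replace (g : 'I_n -> R -> R) (j : 'I_n) :
  (forall i, measurable_fun setT (g i)) -> (forall i y, 0 <= g i y)%R ->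
  (forall i, i != j -> 'E_P[g i \o Y i] \is a fin_num) ->
  (forall B, measurable B ->
    'E_P[fun w => \prod_(i < n) (if i == j then \1_B else g i) (Y i w)]%R =
    \prod_(i < n) 'E_P[(if i == j then \1_B else g i) \o Y i]) ->
  'E_P[fun w => \prod_(i < n) g i (Y i w)]%R = \prod_(i < n) 'E_P[g i \o Y i].
Proof.
move=> mg g_ge0 g_fin indic_prod.
pose F w := (\prod_(i < n | i != j) g i (Y i w))%R.
pose a := \prod_(i < n | i != j) 'E_P[g i \o Y i].
have a_fin : a \is a fin_num by exact: prode_fin_num.
have a_ge0 : 0 <= a by apply: prode_ge0 => i _; apply: expectation_ge0 => w /=.
have mF : measurable_fun setT F.
  rewrite /F; under eq_fun do rewrite -big_filter.
  by apply: measurable_prod => i _; exact: measurableT_comp.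
transitivity 'E_P[fun w => F w * g j (Y j w)]%R.
  by congr 'E_P[_]; apply/funext => w; rewrite (bigD1 j)//= mulrC.
rewrite (bigD1 j)//= muleC -/a -(fineK a_fin).
apply: ge0_expectationM_comp => // [w||B mB].
- exact: prodr_ge0.
- exact: fine_ge0.
rewrite fineK// muleC -expectation_indic_comp//.
transitivity (\prod_(i < n) 'E_P[(if i == j then \1_B else g i) \o Y i]).
  rewrite -indic_prod//; congr 'E_P[_]; apply/funext => w.
  rewrite [RHS](bigD1 j)//= eqxx mulrC; congr (_ * _)%R.
  by apply: eq_bigr => i /negbTE ->.
rewrite (bigD1 j)//= eqxx; congr (_ * _).
by apply: eq_bigr => i /negbTE ->.
Qed.

(* [k] counts the indices that are no longer required to carry an indicator. *)
Let expectation_prod_upto (k : nat) (g : 'I_n -> R -> R) :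
  (forall i, measurable_fun setT (g i)) -> (forall i y, 0 <= g i y)%R ->
  (forall i, 'E_P[g i \o Y i] \is a fin_num) ->
  (forall i : 'I_n, (k <= i)%N -> exists2 B, measurable B & g i = \1_B) ->
  'E_P[fun w => \prod_(i < n) g i (Y i w)]%R = \prod_(i < n) 'E_P[g i \o Y i].
Proof.
elim: k g => [|k IH] g mg g_ge0 g_fin g_indic.
  have /choice[B gB] : forall i, exists B, measurable B /\ g i = \1_B.
    by move=> i; have [B mB gB] := g_indic i (leq0n _); exists B.
  have -> : g = fun i => \1_(B i) by apply/funext => i; exact: (gB i).2.
  by apply: mutual_indep_expectation_indic => i; exact: (gB i).1.
have [nk|kn] := leqP n k.
  by apply: IH => // i; rewrite leqNgt (leq_trans (ltn_ord i)).
apply: (expectation_prod_replace (j := Ordinal kn)) => // B mB.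
apply: IH => [i|i y|i|i ki]; case: ifPn => // ij.
- rewrite expectation_indic_comp// fin_num_measure//.
  exact: measurable_preimageT.
- by exists B.
- apply: g_indic; rewrite ltn_neqAle ki andbT.
  by apply: contraNneq ij => ki'; apply/eqP/val_inj.
Qed.

Lemma mutual_indep_expectation_prod (f : 'I_n -> R -> R) :
  (forall i, measurable_fun setT (f i)) -> (forall i y, 0 <= f i y)%R ->
  (forall i, 'E_P[f i \o Y i] \is a fin_num) ->
  'E_P[fun w => \prod_(i < n) f i (Y i w)]%R = \prod_(i < n) 'E_P[f i \o Y i].
Proof.
move=> mf f_ge0 f_fin; apply: (expectation_prod_upto (k := n)) => // i.
by rewrite leqNgt ltn_ord.
Qed.

End mutual_indep_expectation.

(** * Geometric and exponential decay *)

Lemma nneseries_le_geometric (R : realType) (u : nat -> \bar R) (C r : R)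
    (m : nat) :
  (forall k, (0 <= u k)%E) -> 0 <= C -> 0 <= r < 1 ->
  (forall k, (m <= k)%N -> (u k <= (C * r ^+ k)%:E)%E) ->
  (\sum_(m <= k <oo) u k <= (C * r ^+ m / (1 - r))%:E)%E.
Proof.
move=> u_ge0 C_ge0 /andP[r_ge0 r_lt1] u_le.
apply: lime_le; first exact: is_cvg_nneseries.
near=> n; have mn : (m <= n)%N by near: n; exact: nbhs_infty_ge.
apply: (@le_trans _ _ (\sum_(m <= k < n) (C * r ^+ k)%:E)%E).
  by rewrite !big_nat; apply: lee_sum => k /andP[mk _]; exact: u_le.
rewrite sumEFin lee_fin -mulr_sumr -(subnKC mn) geometric_partial_tail.
rewrite geometric_seriesE ?lt_eqF// -[leRHS]mulrA ler_wpM2l//.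
rewrite ler_pM2r ?invr_gt0 ?subr_gt0// ler_piMr ?exprn_ge0//.
by rewrite lerBlDr lerDl exprn_ge0.
Unshelve. all: by end_near. Qed.

Section geometric_measures.
Local Open Scope ereal_scope.
Context d (T : measurableType d) (R : realType).
Variables (mu : {measure set T -> \bar R}) (F : nat -> set T) (C r : R).
Hypothesis mF : forall k, measurable (F k).
Hypotheses (C_ge0 : (0 <= C)%R) (r01 : (0 <= r < 1)%R).
Hypothesis muF : forall k, mu (F k) <= (C * r ^+ k)%:E.

Lemma measure_bigcup_le_geometric (m : nat) :
  mu (\bigcup_(k >= m) F k) <= (C * r ^+ m / (1 - r))%:E.
Proof.
apply: le_trans _ (nneseries_le_geometric _ C_ge0 r01 (fun k _ => muF k)) => //.
apply: measure_sigma_subadditive_tail => //; first exact: bigcup_measurable.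
by rewrite -setC_I.
Qed.

Lemma ae_eventually_notin_geometric :
  {ae mu, forall w, \forall k \near \oo, ~ F k w}.
Proof.
exists (lim_sup_set F); split.
- by apply: bigcap_measurable => // n _; exact: bigcup_measurable.
- apply: lim_sup_set_cvg0 => //.
  apply: le_lt_trans (ltry _).
  exact: (nneseries_le_geometric _ C_ge0 r01 (fun k _ => muF k)).
- move=> w /= w_often n _; apply: contrapT => w_notin.
  apply: w_often; exists n => // k nk Fkw.
  by apply: w_notin; exists k.
Qed.

End geometric_measures.

Definition exponentially_small (R : realType) (p : R -> \bar R) :=
  exists C g : R, [/\ 0 <= C, 0 < g &
    forall t, 0 < t -> (p t <= (C * expR (- (g * t)))%:E)%E].

Section exponentially_small.
Context (R : realType).
Implicit Types p q : R -> \bar R.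

Lemma exponentially_small_le p q : (forall t, 0 < t -> (p t <= q t)%E) ->
  exponentially_small q -> exponentially_small p.
Proof.
move=> p_q [C [g [C_ge0 g_gt0 q_le]]]; exists C, g; split=> // t t_gt0.
exact: le_trans (p_q t t_gt0) (q_le t t_gt0).
Qed.

Lemma exponentially_smallD p q : exponentially_small p ->
  exponentially_small q -> exponentially_small (fun t => p t + q t)%E.
Proof.
move=> [C [g [C_ge0 g_gt0 p_le]]] [D [h [D_ge0 h_gt0 q_le]]].
exists (C + D), (Num.min g h).
split=> [||t t_gt0]; [exact: addr_ge0|by rewrite lt_min g_gt0|].
rewrite mulrDl EFinD.
apply: leeD;
  [apply: le_trans (p_le _ t_gt0) _|apply: le_trans (q_le _ t_gt0) _].
- by rewrite lee_fin ler_wpM2l// ler_expR lerN2 ler_pM2r// ge_min lexx.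
- by rewrite lee_fin ler_wpM2l// ler_expR lerN2 ler_pM2r// ge_min lexx orbT.
Qed.

Lemma exponentially_small_lt_powR p : exponentially_small p ->
  exists kappa t0 : R, 0 < kappa < 1 /\
    forall t, t0 <= t -> (p t < (kappa `^ t)%:E)%E.
Proof.
move=> [C [g [C_ge0 g_gt0 p_le]]]; exists (expR (- (g / 2))), (2 * (C + 1) / g).
split=> [|t t_ge]; first by rewrite expR_gt0 expR_lt1 oppr_lt0 divr_gt0.
have t_gt0 : 0 < t.
  by apply: lt_le_trans t_ge; rewrite divr_gt0// mulr_gt0 ?ltr_wpDl.
apply: (le_lt_trans (p_le t t_gt0)).
rewrite lte_fin -expRM -ltr_pdivlMr ?expR_gt0// -expRN -expRD.
have -> : - (g / 2) * t - - (g * t) = g * t / 2 by field.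
apply: lt_le_trans (expR_ge1Dx _).
by move: t_ge; rewrite ler_pdivrMr//; lra.
Qed.

Context d (T : measurableType d) (mu : {measure set T -> \bar R}).

Lemma bigcup_geometric_exponentially_small (F : nat -> set T) (C b al : R) :
  (forall k, measurable (F k)) -> 0 <= C -> 0 < b -> 0 < al ->
  (forall k, (mu (F k) <= (C * expR (- b) ^+ k)%:E)%E) ->
  exponentially_small
    (fun t => mu (\bigcup_(k >= (Num.truncn (al * t)).+1) F k)).
Proof.
move=> mF C_ge0 b_gt0 al_gt0 muF.
have r_lt1 : expR (- b) < 1 by rewrite expR_lt1 oppr_lt0.
have r01 : 0 <= expR (- b) < 1 by rewrite expR_ge0.
exists (C / (1 - expR (- b))), (b * al); split.
- by rewrite divr_ge0// subr_ge0 ltW.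
- exact: mulr_gt0.
move=> t t_gt0.
apply: le_trans (measure_bigcup_le_geometric mF C_ge0 r01 muF _) _.
rewrite lee_fin mulrAC ler_wpM2l ?divr_ge0 ?subr_ge0 ?(ltW r_lt1)//.
rewrite -expRM_natl ler_expR mulrN lerN2 -mulrA mulrC ler_wpM2r ?ltW//.
exact: truncnS_gt.
Qed.

End exponentially_small.

(** * Processes with Gaussian increments *)

Definition dyadic (R : realType) (T : R) (k j : nat) : R := T * j%:R / 2 ^+ k.

Section dyadic_chaining.
Context (R : realType).
Implicit Types T : R.

Lemma dyadic_refine T k j : dyadic T k j = dyadic T k.+1 (2 * j).
Proof.
by rewrite /dyadic natrM exprS; field; rewrite expf_neq0// pnatr_eq0.
Qed.

Lemma dyadic_step T k j : dyadic T k j.+1 - dyadic T k j = T / 2 ^+ k.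
Proof. by rewrite /dyadic -mulrBl -mulrBr -natrB ?subSnn ?mulr1. Qed.

Lemma dyadic_ge0 T k j : 0 <= T -> 0 <= dyadic T k j.
Proof. by move=> T_ge0; rewrite divr_ge0 ?mulr_ge0. Qed.

Variables (f : R -> R) (T c q : R).
Hypotheses (c_ge0 : 0 <= c) (q_ge0 : 0 <= q) (q_lt1 : q < 1).
Hypothesis increment_le : forall k j, (j < 2 ^ k)%N ->
  `|f (dyadic T k j.+1) - f (dyadic T k j)| <= c * q ^+ k.

Lemma dyadic_cell_chaining (k : nat) (t : R) : 0 <= t <= T ->
  exists2 j, dyadic T k j <= t <= dyadic T k j.+1 &
    (j < 2 ^ k)%N /\
    `|f (dyadic T k j) - f 0| <= series (geometric c q) k.+1.
Proof.
move=> /andP[t_ge0 t_le]; elim: k => [|k [j /andP[jt tj] [j_lt fj]]].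
  exists 0%N; rewrite /dyadic mulr0 mul0r ?mulr1 ?expr0 ?divr1 ?t_ge0//.
  rewrite subrr normr0; split=> //; apply: sumr_ge0 => i _.
  by rewrite mulr_ge0// exprn_ge0.
have cqk_ge0 : 0 <= c * q ^+ k.+1 by rewrite mulr_ge0// exprn_ge0.
rewrite dyadic_refine in jt; rewrite dyadic_refine mulnS in tj.
rewrite dyadic_refine in fj.
have j2_lt : ((2 * j).+1 < 2 ^ k.+1)%N.
  by rewrite expnS -[(2 * j).+2](mulnS 2 j) leq_mul2l.
have [tm|/ltW mt] := leP t (dyadic T k.+1 (2 * j).+1).
  exists (2 * j)%N; [by rewrite jt|split; first exact: ltnW].
  by apply: (le_trans fj); rewrite [leRHS]seriesSr lerDl.
exists (2 * j).+1; [by rewrite mt|split=> //].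
rewrite -(subrKA (f (dyadic T k.+1 (2 * j)))) seriesSr addrC.
by apply: (le_trans (ler_normD _ _)); apply: lerD => //;
  apply: increment_le; exact: ltnW.
Qed.

Lemma dyadic_chaining : continuous f ->
  forall t, 0 <= t <= T -> `|f t - f 0| <= c / (1 - q).
Proof.
move=> cf t t0T; apply/ler_addgt0Pr => e e_gt0.
have /cvgrPdist_lt/(_ _ e_gt0)/nbhs_ballP[eta /= eta_gt0 feta] := cf t.
have [k Tk] : exists k, T / 2 ^+ k < eta.
  exists (Num.Def.archi_bound (T / eta)); rewrite ltr_pdivrMr ?exprn_gt0//.
  by rewrite -ltr_pdivrMl// mulrC upper_nthrootP.
have [j /andP[jt tj] [_ fj]] := dyadic_cell_chaining k t0T.
rewrite -(subrKA (f (dyadic T k j))) addrC.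
apply: (le_trans (ler_normD _ _)); apply: lerD.
  apply: (le_trans fj); rewrite geometric_seriesE ?lt_eqF//.
  rewrite ler_pM2r ?invr_gt0 ?subr_gt0// ler_piMr//.
  by rewrite lerBlDr lerDl exprn_ge0.
apply/ltW/feta; rewrite /ball/= ger0_norm ?subr_ge0//.
by apply: le_lt_trans Tk; rewrite -(dyadic_step T k j) lerB.
Qed.

End dyadic_chaining.

Lemma expRN_le_invX2 (R : realType) (y : R) : 0 < y -> expR (- y) <= 2 / y ^+ 2.
Proof.
move=> y_gt0; rewrite expRN -[leRHS]invf_div lef_pV2.
- by apply: le_trans (expR_ge1Dxn 1 (ltW y_gt0)); rewrite lerDr.
- by rewrite posrE expR_gt0.
- by rewrite posrE divr_gt0// exprn_gt0.
Qed.

Lemma le_linear_of_dyadic (R : realType) (f : R -> R) (del : R) : 0 <= del ->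
  (\forall N \near \oo,
    forall t, 0 <= t <= 2 ^+ N -> `|f t| <= del / 2 * 2 ^+ N) ->
  \forall t \near +oo, `|f t| <= del * t.
Proof.
move=> del_ge0 [m _ f_le]; near=> t.
have mt : 2 ^+ m <= t by near: t; apply: nbhs_pinfty_ge; exact: num_real.
have t_ge0 : 0 <= t by apply: le_trans mt; rewrite exprn_ge0.
have [N tN] : exists N, t <= 2 ^+ N.
  by exists (Num.Def.archi_bound t); rewrite ltW// upper_nthrootP.
have {N tN} [N tN N_min] := ex_minnP (ex_intro (fun N => t <= 2 ^+ N) N tN).
have [Nm|mN] := leqP N m.
  have tm : 0 <= t <= 2 ^+ m.
    by rewrite t_ge0 (le_trans tN)// ler_weXn2l// ler1n.
  apply: (le_trans (f_le _ (leqnn m) _ tm)).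
  by apply: ler_pM; rewrite ?divr_ge0 ?exprn_ge0// ler_piMr// invf_le1// ler1n.
case: N mN => // N mN in tN N_min *.
apply: (le_trans (f_le N.+1 (ltnW mN) t _)); first by rewrite t_ge0.
rewrite exprS mulrA divfK// ler_wpM2l// leNgt; apply/negP => /ltW/N_min.
by rewrite ltnn.
Unshelve. all: by end_near. Qed.

Definition gaussian_increments d (T : measurableType d) (R : realType)
    (P : probability T R) (W : R -> T -> R) :=
  forall s t B, 0 <= s -> s < t -> measurable B ->
    P ((fun w => W t w - W s w) @^-1` B) = normal_prob 0 (Num.sqrt (t - s)) B.

(* Chaining over the dyadic grids of [0, 2^N]: an increment over a cell of
   length 2^(N-k) exceeds eps 2^N q^k with probability of order
   4^-N (2 q^4)^-k 2^-k, which is summable over the 2^k cells, over k, and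
   over N. *)
Section gaussian_increments.
Local Open Scope ereal_scope.
Context d (T : measurableType d) (R : realType) (P : probability T R).
Variable W : R -> T -> R.
Hypothesis W0 : forall w, W 0%R w = 0%R.
Hypothesis cW : forall w, continuous (fun t => W t w).
Hypothesis mW : forall t, measurable_fun setT (W t).
Hypothesis gaussW : gaussian_increments P W.

Lemma gaussian_increment_tail (s t a : R) :
  (0 <= s)%R -> (s < t)%R -> (0 < a)%R ->
  P [set w | a <= `|W t w - W s w|]%R <=
    (2 * expR (- a ^+ 2 / ((t - s) *+ 2)))%:E.
Proof.
move=> s_ge0 st a_gt0; have ts_gt0 : (0 < t - s)%R by rewrite subr_gt0.
rewrite -[(t - s)%R in leRHS]sqr_sqrtr ?(ltW ts_gt0)//.
apply: (normal_tail (Y := (W t \- W s)%R)) => //.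
- exact: measurable_funB.
- by rewrite gt_eqF// sqrtr_gt0.
- by move=> B mB; exact: gaussW.
Qed.

Variables (eps q : R).
Hypotheses (eps_gt0 : (0 < eps)%R) (q_gt0 : (0 < q)%R) (q_lt1 : (q < 1)%R).
Hypothesis q4 : (1 < 2 * q ^+ 4)%R.

Let large_increment N k j := [set w | eps * 2 ^+ N * q ^+ k <=
  `|W (dyadic (2 ^+ N) k j.+1) w - W (dyadic (2 ^+ N) k j) w| ]%R.

Let measurable_large_increment N k j : measurable (large_increment N k j).
Proof.
apply: measurable_set_bool; apply: measurable_fun_ler => //.
by apply: measurableT_comp => //; exact: measurable_funB.
Qed.

Let large_increment_le N k j :
  P (large_increment N k j) <=
    (16 / eps ^+ 4 * (1 / 4) ^+ N * (1 / (2 * q ^+ 4)) ^+ k / 2 ^+ k)%:E.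
Proof.
have A_gt0 : (0 < 2 ^+ N :> R)%R by rewrite exprn_gt0.
have B_gt0 : (0 < 2 ^+ k :> R)%R by rewrite exprn_gt0.
have Q_gt0 : (0 < q ^+ k)%R by rewrite exprn_gt0.
apply: (le_trans (gaussian_increment_tail _ _ _)).
- by rewrite dyadic_ge0// ltW.
- by rewrite -subr_gt0 dyadic_step divr_gt0.
- by rewrite !mulr_gt0.
have -> : ((1 / 4) ^+ N = 1 / (2 ^+ N) ^+ 2 :> R)%R.
  by rewrite expr_div_n expr1n exprAC -natrX.
have -> : ((1 / (2 * q ^+ 4)) ^+ k = 1 / (2 ^+ k * (q ^+ k) ^+ 4))%R.
  by rewrite expr_div_n expr1n exprMn [((q ^+ k) ^+ 4)%R]exprAC.
rewrite dyadic_step lee_fin -[(_ / _ *+ 2)%R]mulr_natr.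
move: (2 ^+ N)%R (2 ^+ k)%R (q ^+ k)%R A_gt0 B_gt0 Q_gt0.
move=> A B Q A_gt0 B_gt0 Q_gt0.
set y := (eps ^+ 2 / 2 * A * B * Q ^+ 2)%R.
have y_gt0 : (0 < y)%R by rewrite !mulr_gt0 ?invr_gt0 ?exprn_gt0.
have -> : (- (eps * A * Q) ^+ 2 / (A / B * 2) = - y)%R.
  by rewrite /y; field; rewrite !gt_eqF.
have -> : (16 / eps ^+ 4 * (1 / A ^+ 2) * (1 / (B * Q ^+ 4)) / B =
    2 * (2 / y ^+ 2))%R by rewrite /y; field; rewrite !gt_eqF.
by rewrite ler_pM2l// expRN_le_invX2.
Qed.

Let large_level N k := \big[setU/set0]_(j < 2 ^ k) large_increment N k j.

Let large_level_le N k :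
  P (large_level N k) <=
    (16 / eps ^+ 4 * (1 / 4) ^+ N * (1 / (2 * q ^+ 4)) ^+ k)%:E.
Proof.
apply: (le_trans (Boole_inequality P _)) => [j _|].
  exact: measurable_large_increment.
apply: (le_trans (lee_sum _ _)) => [j _|]; first exact: large_increment_le.
by rewrite sumEFin lee_fin sumr_const card_ord -[leLHS]mulr_natr natrX divfK.
Qed.

Lemma gaussian_ae_le_dyadic : {ae P, forall w, \forall N \near \oo,
  forall t, (0 <= t <= 2 ^+ N -> `|W t w| <= eps * 2 ^+ N / (1 - q))%R}.
Proof.
pose s := (1 / (2 * q ^+ 4))%R.
have q4_gt0 : (0 < 2 * q ^+ 4)%R by rewrite mulr_gt0 ?exprn_gt0.
have s01 : (0 <= s < 1)%R by rewrite divr_ge0 ?ltW//= ltr_pdivrMr// mul1r.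
have eps4_ge0 : (0 <= 16 / eps ^+ 4)%R by rewrite divr_ge0 ?exprn_ge0 ?ltW.
have m_level N k : measurable (large_level N k) by exact: bigsetU_measurable.
have scale_le N : P (\bigcup_k large_level N k) <=
    (16 / eps ^+ 4 / (1 - s) * (1 / 4) ^+ N)%:E.
  have C_ge0 : (0 <= 16 / eps ^+ 4 * (1 / 4) ^+ N)%R.
    by rewrite mulr_ge0// exprn_ge0.
  have := measure_bigcup_le_geometric (m_level N) C_ge0 s01
    (large_level_le N) 0.
  rewrite expr0 mulr1 mulrAC; congr (P _ <= _).
  by apply: eq_bigcupl; split.
have m_scale N : measurable (\bigcup_k large_level N k).
  exact: bigcupT_measurable.
have K_ge0 : (0 <= 16 / eps ^+ 4 / (1 - s))%R.
  by rewrite divr_ge0// subr_ge0 ltW//; case/andP: s01.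
have quarter : (0 <= (1 / 4 : R) < 1)%R by apply/andP; split; lra.
have := ae_eventually_notin_geometric m_scale K_ge0 quarter scale_le.
apply: filterS => w [m _ small]; exists m => // N mN t tN.
rewrite -[W t w]subr0 -(W0 w).
apply: (@dyadic_chaining R (W ^~ w) (2 ^+ N)) => //.
- by rewrite mulr_ge0 ?exprn_ge0 ?ltW.
- exact: ltW.
- move=> k j jk; rewrite leNgt; apply/negP => /ltW large.
  apply: (small N mN); exists k => //.
  by rewrite /large_level -bigcup_mkord; exists j.
Qed.

End gaussian_increments.

Lemma gaussian_ae_sublinear d (T : measurableType d) (R : realType)
    (P : probability T R) (W : R -> T -> R) (del : R) :
  (forall w, W 0 w = 0) -> (forall w, continuous (fun t => W t w)) ->
  (forall t, measurable_fun setT (W t)) -> gaussian_increments P W -> 0 < del ->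
  {ae P, forall w, \forall t \near +oo, `|W t w| <= del * t}.
Proof.
move=> W0 cW mW gaussW del_gt0.
have eps_gt0 : 0 < del / 20 by rewrite divr_gt0.
have [q [q_gt0 q_lt1 q4 qE]] : exists q : R,
    [/\ 0 < q, q < 1, 1 < 2 * q ^+ 4 & 1 - q = 1 / 10].
  by exists (9 / 10); split; lra.
have := gaussian_ae_le_dyadic W0 cW mW gaussW eps_gt0 q_gt0 q_lt1 q4.
apply: filterS => w W_le; apply: le_linear_of_dyadic; first exact: ltW.
apply: filterS W_le => N W_le t tN.
have -> : del / 2 * 2 ^+ N = del / 20 * 2 ^+ N / (1 - q) by rewrite qE; field.
exact: W_le.
Qed.

Lemma gaussian_exponentially_small d (T : measurableType d) (R : realType)
    (P : probability T R) (W : R -> T -> R) (c : R) :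
  (forall t, measurable_fun setT (W t)) -> gaussian_increments P W -> 0 < c ->
  exponentially_small (fun t => P [set w | c * t <= `|W t w - W 0 w|]).
Proof.
move=> mW gaussW c_gt0; exists 2, (c ^+ 2 / 2); split=> //.
  by rewrite divr_gt0// exprn_gt0.
move=> t t_gt0.
apply: le_trans (gaussian_increment_tail mW gaussW (lexx 0) t_gt0 _) _.
  exact: mulr_gt0.
have -> : c ^+ 2 / 2 * t = (c * t) ^+ 2 / ((t - 0) *+ 2).
  by rewrite subr0 -[t *+ 2]mulr_natr; field; rewrite gt_eqF.
by rewrite mulNr.
Qed.

(** * Sums of exponential sojourn times *)

Definition reward_sum (R : realType) (Omega : Type) (a : nat -> R)
    (tau : nat -> Omega -> R) (k : nat) (w : Omega) : R :=
  \sum_(j < k) a j * tau j w.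

Lemma jump_timeE (R : realType) (Omega : Type) (tau : nat -> Omega -> R) k :
  jump_time tau k = reward_sum (fun=> 1) tau k.
Proof. by apply/funext => w; apply: eq_bigr => j _; rewrite mul1r. Qed.

Section independent_exponentials.
Local Open Scope ereal_scope.
Context d (T : measurableType d) (R : realType) (P : probability T R).
Variables (tau : nat -> T -> R) (rate : nat -> R).
Hypothesis mtau : forall k, measurable_fun setT (tau k).
Hypothesis rate_gt0 : forall k, (0 < rate k)%R.
Hypothesis indep_tau : forall k, mutual_indep P (fun i : 'I_k => tau i).
Hypothesis tau_law : forall k B, measurable B ->
  P (tau k @^-1` B) = exponential_prob (rate k) B.

Lemma measurable_reward_sum (a : nat -> R) (k : nat) :
  measurable_fun setT (reward_sum a tau k).
Proof. by apply: measurable_sum => j; exact: measurable_funM. Qed.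

Lemma reward_sum_mgf (a : nat -> R) (k : nat) (th : R) :
  (forall j, th * a j < rate j)%R ->
  'M_P (reward_sum a tau k) th =
  (\prod_(j < k) (rate j / (rate j - th * a j)))%:E.
Proof.
move=> th_rate.
have factor_mgf (j : 'I_k) : 'E_P[(fun y => expR (y * (th * a j))) \o tau j]%R =
    (rate j / (rate j - th * a j))%:E.
  by apply: exponential_mgf => // B mB; exact: tau_law.
transitivity 'E_P[fun w => \prod_(j < k) expR (tau j w * (th * a j))]%R.
  congr 'E_P[_]; apply/funext => w /=; rewrite /reward_sum mulr_suml expR_sum.
  by apply: eq_bigr => j _; congr expR; ring.
rewrite (@mutual_indep_expectation_prod _ _ _ _ _ (fun j : 'I_k => tau j) _ _
  (fun (j : 'I_k) y => expR (y * (th * a j)))) => [|//|//|j||j].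
- by rewrite -prodEFin; apply: eq_bigr => j _; exact: factor_mgf.
- by apply: measurableT_comp => //; exact: measurable_funM.
- by move=> j y; exact: expR_ge0.
- by rewrite factor_mgf.
Qed.

Lemma jump_time_tail (a : R) (m : nat) (t : R) :
  (0 < a)%R -> (forall k, a *+ 2 <= rate k)%R ->
  P [set w | t <= jump_time tau m w]%R <= (expR (m%:R - a * t))%:E.
Proof.
move=> a_gt0 a_rate; rewrite jump_timeE.
apply: le_trans (chernoff_ge P t (measurable_reward_sum _ m) a_gt0) _.
rewrite reward_sum_mgf => [|j]; last by have := a_rate j; lra.
rewrite -EFinM lee_fin expRD ler_wpM2r ?expR_ge0//.
rewrite -[m%:R]mulr1 expRM_natl -[m in leRHS]card_ord -prodr_const.
apply: ler_prod => j _; have aj := a_rate j.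
have gap_gt0 : (0 < rate j - a * 1)%R by lra.
rewrite divr_ge0 ?(ltW gap_gt0) ?(ltW (rate_gt0 j))//=.
apply: (@le_trans _ _ 2%R).
  by rewrite ler_pdivrMr//; lra.
by have := expR_ge1Dx (1 : R); lra.
Qed.

Lemma late_jump_exponentially_small (al : R) :
  (0 < al)%R -> (forall k, al *+ 4 <= rate k)%R ->
  exponentially_small
    (fun t => P [set w | t <= jump_time tau (Num.truncn (al * t)).+1 w]%R).
Proof.
move=> al_gt0 al_rate.
exists (expR 1), al; split=> [||t t_gt0]; [exact: expR_ge0|by []|].
have al2_rate k : ((al *+ 2) *+ 2 <= rate k)%R by rewrite -mulrnA.
have al2_gt0 : (0 < al *+ 2)%R by rewrite pmulrn_lgt0.
apply: le_trans (jump_time_tail _ t al2_gt0 al2_rate) _.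
rewrite lee_fin -expRD ler_expR -natr1.
have : ((Num.truncn (al * t))%:R <= al * t)%R.
  by rewrite truncn_le// mulr_ge0 ?ltW.
lra.
Qed.

End independent_exponentials.

Lemma exists_contracting_tilt (R : realFieldType) (lp lm gp gm : R) :
  0 < lp -> 0 < lm -> 0 < gp -> 0 < gm -> gm / lm < gp / lp ->
  exists2 th, 0 < th & th * gm < lm /\
    lp / (lp + th * gp) * (lm / (lm - th * gm)) < 1.
Proof.
move=> lp_gt0 lm_gt0 gp_gt0 gm_gt0.
rewrite ltr_pdivrMr// mulrAC ltr_pdivlMr// => gain_cross.
(* [th] maximizes [(lp + th gp) (lm - th gm)], which is [lp lm] at [th = 0]. *)
pose th := (gp * lm - gm * lp) / (2 * gp * gm).
have th_gt0 : 0 < th by rewrite divr_gt0 ?subr_gt0// !mulr_gt0.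
have thE : th * (2 * gp * gm) = gp * lm - gm * lp.
  by rewrite divfK// gt_eqF// !mulr_gt0.
have gl_gt0 := mulr_gt0 gp_gt0 lm_gt0; have lg_gt0 := mulr_gt0 gm_gt0 lp_gt0.
have up_gt0 : 0 < lp + th * gp by rewrite addr_gt0// mulr_gt0.
have down_gt0 : 0 < lm - th * gm.
  have : 0 < (lm - th * gm) * (2 * gp) by lra.
  by rewrite pmulr_lgt0// mulr_gt0.
exists th => //; split; first by rewrite -subr_gt0.
rewrite mulf_div ltr_pdivrMr ?mulr_gt0// mul1r.
have := mulr_gt0 th_gt0 (mulr_gt0 th_gt0 (mulr_gt0 gp_gt0 gm_gt0)).
have : th * (th * (2 * gp * gm)) = th * (gp * lm - gm * lp) by rewrite thE.
lra.
Qed.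

Lemma prod_sojourn_state_le (R : realFieldType) (phi : bool -> R) (r : R)
    (z : bool) (k : nat) :
  (forall s, 0 < phi s) -> 0 < r -> phi true * phi false <= r ^+ 2 ->
  \prod_(j < k) phi (sojourn_state z j) <= (1 + phi z / r) * r ^+ k.
Proof.
move=> phi_gt0 r_gt0 phi_r; elim: k z => [|k IH] z.
  by rewrite big_ord0 expr0 mulr1 lerDl divr_ge0// ltW.
rewrite big_ord_recl; under eq_bigr => j _.
  rewrite (_ : sojourn_state z _ = sojourn_state (~~ z) j); last first.
    by rewrite /sojourn_state lift0/= negbK; case: odd.
  over.
apply: (le_trans (ler_wpM2l (ltW (phi_gt0 _)) (IH _))).
rewrite exprS !mulrA ler_pM2r ?exprn_gt0//.
have phi2 : phi z * phi (~~ z) <= r ^+ 2 by case: z; rewrite // mulrC.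
have : phi z * phi (~~ z) / r <= r by rewrite ler_pdivrMr// -expr2.
rewrite /sojourn_state/= mulrDr mulrDl divfK ?gt_eqF// mulr1 mul1r mulrA.
lra.
Qed.

Definition slope (R : realType) (gp gm : R) (s : bool) : R :=
  if s then gp else - gm.

Section alternating_reward.
Context d (T : measurableType d) (R : realType) (P : probability T R).
Variables (tau : nat -> T -> R) (z : bool) (lp lm gp gm : R).
Hypotheses (lp_gt0 : 0 < lp) (lm_gt0 : 0 < lm).
Hypotheses (gp_gt0 : 0 < gp) (gm_gt0 : 0 < gm) (gain : gm / lm < gp / lp).
Local Notation rate := (fun k => leave_rate lp lm (sojourn_state z k)).
Local Notation reward := (fun k => slope gp gm (sojourn_state z k)).
Hypothesis mtau : forall k, measurable_fun setT (tau k).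
Hypothesis indep_tau : forall k, mutual_indep P (fun i : 'I_k => tau i).
Hypothesis tau_law : forall k B, measurable B ->
  P (tau k @^-1` B) = exponential_prob (rate k) B.

Let tilted_rate (th : R) (s : bool) := leave_rate lp lm s + th * slope gp gm s.

Let reward_sum_laplace (th : R) (k : nat) :
  0 < th -> th * gm < lm ->
  'M_P (reward_sum reward tau k) (- th) =
  (\prod_(j < k) (rate j / tilted_rate th (sojourn_state z j)))%:E.
Proof.
move=> th_gt0 th_lm.
have rate_gt0 j : 0 < rate j by rewrite /leave_rate; case: ifP.
rewrite (reward_sum_mgf mtau rate_gt0 indep_tau tau_law) => [|j].
  by congr EFin; apply: eq_bigr => j _; rewrite mulNr opprK.
rewrite /slope /leave_rate; case: ifP => _; last by rewrite mulrNN.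
by rewrite mulNr (lt_trans _ lp_gt0)// oppr_lt0 mulr_gt0.
Qed.

Lemma alternating_reward_tail : exists C b del : R,
  [/\ 0 <= C, 0 < b, 0 < del &
    forall k, (P [set w | reward_sum reward tau k w <= del * k%:R]%R <=
      (C * expR (- b) ^+ k)%:E)%E].
Proof.
have [th th_gt0 [th_lm tilt_lt1]] :=
  exists_contracting_tilt lp_gt0 lm_gt0 gp_gt0 gm_gt0 gain.
pose phi s := leave_rate lp lm s / tilted_rate th s.
have phi_gt0 s : 0 < phi s.
  rewrite /phi /tilted_rate /leave_rate /slope; case: s; rewrite divr_gt0//.
    by rewrite addr_gt0// mulr_gt0.
  by rewrite mulrN subr_gt0.
have phi_prod_gt0 : 0 < phi true * phi false by exact: mulr_gt0.
have phi_prod_lt1 : phi true * phi false < 1.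
  by rewrite /phi /tilted_rate/= mulrN.
pose b := - ln (phi true * phi false) / 4.
have b_gt0 : 0 < b by rewrite divr_gt0// oppr_gt0 ln_lt0// phi_prod_gt0.
have phi_prodE : phi true * phi false = expR (- b *+ 2) ^+ 2.
  rewrite -expRM_natl -[LHS]lnK ?posrE//; congr expR.
  by rewrite /b; field.
have C_ge0 : 0 <= 1 + phi z / expR (- b *+ 2).
  by rewrite addr_ge0// divr_ge0 ?expR_ge0 ?ltW.
exists (1 + phi z / expR (- b *+ 2)), b, (b / th); split=> //.
  by rewrite divr_gt0.
move=> k; have m_reward := measurable_reward_sum mtau reward k.
apply: le_trans (chernoff_le P _ m_reward th_gt0) _.
rewrite reward_sum_laplace// -EFinM lee_fin.
have -> : expR (- b) ^+ k = expR (- b *+ 2) ^+ k * expR (th * (b / th * k%:R)).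
  rewrite -!expRM_natl -expRD; congr expR.
  by field; rewrite gt_eqF.
rewrite [leRHS]mulrA ler_wpM2r ?expR_ge0//; apply: prod_sojourn_state_le => //.
  exact: expR_gt0.
by rewrite phi_prodE.
Qed.

End alternating_reward.

(** * Rewards along a path *)

(* With rewards [a], the broken line of slope [a j] on the [j]-th sojourn,
   evaluated at a time [t] of the [k]-th one. *)
Definition reward_at (R : realType) (Omega : Type) (a : nat -> R)
    (tau : nat -> Omega -> R) (k : nat) (t : R) (w : Omega) : R :=
  reward_sum a tau k w + a k * (t - jump_time tau k w).

Section reward_path.
Context (R : realType) (Omega : Type) (tau : nat -> Omega -> R) (w : Omega).
Hypothesis tau_ge0 : forall k, 0 <= tau k w.
Implicit Types a : nat -> R.

Lemma jump_timeS k : jump_time tau k.+1 w = jump_time tau k w + tau k w.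
Proof. by rewrite /jump_time big_ord_recr. Qed.

Lemma jump_time_ge0 k : 0 <= jump_time tau k w.
Proof. exact: sumr_ge0. Qed.

Lemma jump_time_homo : {homo jump_time tau ^~ w : m n / (m <= n)%N >-> m <= n}.
Proof.
by apply: homo_leq => [//|x y v|k]; [exact: le_trans|rewrite jump_timeS lerDl].
Qed.

Lemma jump_time_bracket (m : nat) (t : R) :
  jump_time tau m w <= t -> (exists k, t < jump_time tau k w) ->
  exists2 k, (m <= k)%N & jump_time tau k w <= t < jump_time tau k.+1 w.
Proof.
move=> mt t_lt; have [k tk k_min] := ex_minnP t_lt.
have mk : (m < k)%N.
  rewrite ltnNge; apply/negP => /jump_time_homo km.
  by have := lt_le_trans tk (le_trans km mt); rewrite ltxx.
case: k mk => // k mk in tk k_min *; exists k => //.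
by rewrite tk andbT leNgt; apply/negP => /k_min; rewrite ltnn.
Qed.

Lemma reward_sumS a k :
  reward_sum a tau k.+1 w = reward_sum a tau k w + a k * tau k w.
Proof. by rewrite /reward_sum big_ord_recr. Qed.

Lemma reward_sum_le a (g : R) k : (forall j, a j <= g) ->
  reward_sum a tau k w <= g * jump_time tau k w.
Proof.
by move=> a_le; rewrite mulr_sumr; apply: ler_sum => j _; rewrite ler_wpM2r.
Qed.

Lemma jump_time_unbounded a (g del : R) (m : nat) : 0 < del ->
  (forall j, a j <= g) ->
  (forall k, (m <= k)%N -> del * k%:R <= reward_sum a tau k w) ->
  forall t, exists k, t < jump_time tau k w.
Proof.
move=> del_gt0 a_le reward_ge t.
pose k := (m + (Num.truncn (`|g| * `|t| / del)).+1)%N; exists k.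
rewrite ltNge; apply/negP => Jt.
have Jt_norm : jump_time tau k w <= `|t| by rewrite (le_trans Jt)// ler_norm.
have k_big : `|g| * `|t| < del * k%:R.
  rewrite [ltRHS]mulrC -ltr_pdivrMr//; apply: lt_le_trans (truncnS_gt _) _.
  by rewrite ler_nat leq_addl.
have := le_trans (reward_ge k (leq_addr _ _)) (reward_sum_le k a_le).
apply/negP; rewrite -ltNge; apply: le_lt_trans k_big.
apply: (@le_trans _ _ (`|g| * jump_time tau k w)).
  by rewrite ler_wpM2r ?jump_time_ge0// ler_norm.
by rewrite ler_wpM2l.
Qed.

Lemma reward_at_jump a k :
  reward_at a tau k (jump_time tau k.+1 w) w = reward_sum a tau k.+1 w.
Proof.
by rewrite /reward_at jump_timeS [_ + tau k w]addrC addrK reward_sumS.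
Qed.

Lemma reward_atD_cst a (c : R) k t :
  reward_at (fun j => a j + c) tau k t w = reward_at a tau k t w + c * t.
Proof.
rewrite /reward_at (_ : reward_sum _ _ _ _ =
    reward_sum a tau k w + c * jump_time tau k w); last first.
  by rewrite mulr_sumr -big_split; apply: eq_bigr => j _; rewrite mulrDl.
by ring.
Qed.

Lemma reward_at_ge0 a k t : jump_time tau k w <= t <= jump_time tau k.+1 w ->
  0 <= reward_sum a tau k w -> 0 <= reward_sum a tau k.+1 w ->
  0 <= reward_at a tau k t w.
Proof.
move=> /andP[kt tk] S_ge0; have [a_ge0 _|a_lt0] := leP 0 (a k).
  by rewrite addr_ge0// mulr_ge0// subr_ge0.
rewrite -reward_at_jump => /le_trans; apply.
by rewrite lerD2l ler_nM2l// lerB.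
Qed.

End reward_path.

Section bounded_integrand.
Context (R : realType) (f : R -> R) (M : R).
Hypothesis mf : forall t : R, 0 <= t -> measurable_fun `[0, t] f.
Hypothesis f_le : forall s, `|f s| <= M.
Local Notation mu := (@lebesgue_measure R).

Let integrable_f (t : R) : 0 <= t -> mu.-integrable `[0, t] (EFin \o f).
Proof.
move=> t_ge0; apply: measurable_bounded_integrable => //.
- by rewrite /= lebesgue_measure_itv/=; case: ifP => _; rewrite ltry.
- exact: mf.
- exists M; split; first exact: num_real.
  by move=> N MN s _; exact: le_trans (f_le s) (ltW MN).
Qed.

Lemma Rintegral_itv_slope_ge (a b s : R) : 0 <= a -> a <= b ->
  (forall y, a <= y < b -> s <= f y) ->
  \int[mu]_(y in `[0, a]) f y + s * (b - a) <= \int[mu]_(y in `[0, b]) f y.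
Proof.
move=> a_ge0 ab sf; have b_ge0 := le_trans a_ge0 ab.
rewrite addrC -lerBrDr Rintegral_itvB;
  [|exact: integrable_f|by rewrite bnd_simp..].
have int_ab : mu.-integrable `]a, b[ (EFin \o f).
  apply: integrableS (integrable_f b_ge0) => //.
  by apply: subset_itv; rewrite bnd_simp.
rewrite -Rintegral_itv_bndo_bndc//.
have <- : \int[mu]_(y in `]a, b[) s = s * (b - a).
  rewrite Rintegral_cst//= lebesgue_measure_itv/= lte_fin.
  by move: ab; rewrite le_eqVlt => /predU1P[->|->//]; rewrite ltxx subrr.
apply: le_Rintegral => //.
  apply: measurable_bounded_integrable => //.
  - by rewrite /= lebesgue_measure_itv/=; case: ifP => _; rewrite ltry.
  - exists `|s|; split; first exact: num_real.
    by move=> N MN y _; exact: ltW.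
by move=> y /=; rewrite in_itv/= => /andP[ay yb]; apply: sf; rewrite (ltW ay).
Qed.

Variables (Omega : Type) (tau : nat -> Omega -> R) (w : Omega).
Hypothesis tau_ge0 : forall k, 0 <= tau k w.

Lemma reward_at_le_Rintegral (a : nat -> R) :
  (forall k y, jump_time tau k w <= y < jump_time tau k.+1 w -> a k <= f y) ->
  forall k t, jump_time tau k w <= t <= jump_time tau k.+1 w ->
    reward_at a tau k t w <= \int[mu]_(y in `[0, t]) f y.
Proof.
move=> a_f; elim=> [|k IH] t /andP[kt tk].
  have := @Rintegral_itv_slope_ge (jump_time tau 0 w) t (a 0%N).
  rewrite {1 4}/jump_time big_ord0 set_itv1 Rintegral_set1.
  rewrite /reward_at /reward_sum big_ord0; apply=> // y /andP[ky yt].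
  by apply: a_f; rewrite ky (lt_le_trans yt).
have kt_slope y : jump_time tau k.+1 w <= y < t -> a k.+1 <= f y.
  by move=> /andP[ky yt]; apply: a_f; rewrite ky (lt_le_trans yt).
apply: le_trans (Rintegral_itv_slope_ge (jump_time_ge0 tau_ge0 _) kt kt_slope).
rewrite lerD2r -reward_at_jump; apply: IH.
by rewrite lexx andbT jump_timeS lerDl.
Qed.

Lemma Rintegral_ge_linear (a : nat -> R) (g c del : R) (m : nat) (t : R) :
  0 < del -> (forall j, a j <= g) ->
  (forall k y, jump_time tau k w <= y < jump_time tau k.+1 w ->
    a k + c <= f y) ->
  (forall k, (m <= k)%N -> del * k%:R <= reward_sum a tau k w) ->
  jump_time tau m w <= t ->
  c * t <= \int[mu]_(y in `[0, t]) f y.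
Proof.
move=> del_gt0 a_le a_f reward_ge mt.
have no_explosion := jump_time_unbounded tau_ge0 del_gt0 a_le reward_ge t.
have [k mk /andP[kt /ltW tk]] := jump_time_bracket tau_ge0 mt no_explosion.
have kt_tk : jump_time tau k w <= t <= jump_time tau k.+1 w by rewrite kt.
apply: le_trans (reward_at_le_Rintegral a_f kt_tk).
have reward_ge0 j : (m <= j)%N -> 0 <= reward_sum a tau j w.
  by move=> mj; apply: le_trans (reward_ge j mj); rewrite mulr_ge0// ltW.
by rewrite reward_atD_cst lerDr reward_at_ge0// reward_ge0// (leqW mk).
Qed.

End bounded_integrand.

(** * The switching diffusion *)

Lemma ae_subset_le_measure d (T : measurableType d) (R : realType)
    (mu : {measure set T -> \bar R}) (A B : set T) :
  measurable A -> measurable B -> {ae mu, forall w, A w -> B w} ->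
  (mu A <= mu B)%E.
Proof.
move=> mA mB [N [mN muN0 AB]].
apply: (@le_trans _ _ (mu (N `|` B))).
  apply: le_measure; rewrite ?inE//; first exact: measurableU.
  by move=> w Aw; apply: contrapT => /not_orP[Nw nBw]; apply/Nw/AB => /(_ Aw).
by have := measureU2 mu mN mB; rewrite [X in (_ <= X + _)%E]muN0 add0e.
Qed.

Section linear_minorant.
Context (R : realType) (f : R -> R) (x c : R).
Hypothesis f_ge : \forall t \near +oo, x + c * t <= f t.

Lemma linear_minorant_cvgry : 0 < c -> f @ +oo --> +oo.
Proof.
move=> c_gt0; apply/cvgryPge => A; near=> t.
have tA : (A - x) / c <= t by near: t; apply: nbhs_pinfty_ge; exact: num_real.
apply: (@le_trans _ _ (x + c * t)); last by near: t.
by rewrite -lerBlDl mulrC -ler_pdivrMr.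
Unshelve. all: by end_near. Qed.

Lemma linear_minorant_div_gt (e : R) : 0 < e ->
  \forall t \near +oo, c - e < f t / t.
Proof.
move=> e_gt0; near=> t.
have t_gt0 : 0 < t by near: t; apply: nbhs_pinfty_gt; exact: num_real.
have te : - x / e < t by near: t; apply: nbhs_pinfty_gt; exact: num_real.
rewrite ltr_pdivlMr//; apply: (@lt_le_trans _ _ (x + c * t)); last by near: t.
by move: te; rewrite ltr_pdivrMr//; lra.
Unshelve. all: by end_near. Qed.

End linear_minorant.

Section wiener_and_sojourns.
Context (R : realType) d (T : measurableType d) (P : probability T R).
Variables (W : R -> T -> R) (tau : nat -> T -> R) (z : bool) (lp lm : R).
Hypothesis noise : wiener_and_sojourns P W tau z lp lm.

Lemma wiener_gaussian_increments : gaussian_increments P W.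
Proof.
case: noise => _ _ _ _ joint s t B.
rewrite le_eqVlt => /predU1P[<-|s_gt0] st mB.
  have [] := joint 1%N 0%N (nth 0 [:: 0; t]) erefl; first by case.
  by move=> _ /(_ ord0 B mB).
have [] := joint 2%N 0%N (nth 0 [:: 0; s; t]) erefl; first by case=> [|[]].
by move=> _ /(_ (@Ordinal 2 1 isT) B mB).
Qed.

Lemma sojourn_law k (B : set R) : measurable B ->
  P (tau k @^-1` B) = exponential_prob (leave_rate lp lm (sojourn_state z k)) B.
Proof.
move=> mB; case: noise => _ _ _ _ /(_ 0%N k.+1 (fun i => i%:R) erefl)[]// _ _.
by move=> /(_ ord_max B mB).
Qed.

Lemma sojourns_ae_ge0 : {ae P, forall w, forall k, 0 <= tau k w}.
Proof.
apply: ae_foralln => k; apply: exponential_ae_ge0 (sojourn_law k).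
by case: noise.
Qed.

Lemma sojourn_mutual_indep k : mutual_indep P (fun i : 'I_k => tau i).
Proof.
case: noise => _ _ _ _ /(_ 0%N k (fun i => i%:R) erefl)[]// + _ _.
congr mutual_indep; apply/funext => i.
by case: (fintype.split i) (splitK i) => [[]//|j] <-.
Qed.

End wiener_and_sojourns.

(* Half of the value of [c] at which [(rp - c) / lp = (rm + c) / lm]. *)
Definition drift_slack (R : realFieldType) (lp lm rp rm : R) : R :=
  (rp * lm - rm * lp) / (2 * (lp + lm)).

Section drift_slack.
Context (R : realFieldType) (lp lm rp rm : R).
Hypotheses (lp_gt0 : 0 < lp) (lm_gt0 : 0 < lm) (rm_gt0 : 0 < rm).
Hypothesis gain : rm / lm < rp / lp.
Local Notation c := (drift_slack lp lm rp rm).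

Let gain_cross : rm * lp < rp * lm.
Proof. by move: gain; rewrite ltr_pdivrMr// mulrAC ltr_pdivlMr. Qed.

Lemma drift_slack_gt0 : 0 < c.
Proof. by rewrite divr_gt0 ?subr_gt0// mulr_gt0// addr_gt0. Qed.

Let drift_slackE : c * (2 * (lp + lm)) = rp * lm - rm * lp.
Proof. by rewrite divfK// gt_eqF// mulr_gt0// addr_gt0. Qed.

Lemma drift_slack_lt : c < rp.
Proof.
have clp := mulr_gt0 drift_slack_gt0 lp_gt0.
have clm := mulr_gt0 drift_slack_gt0 lm_gt0.
have rmlp := mulr_gt0 rm_gt0 lp_gt0.
by rewrite -subr_gt0 -(pmulr_lgt0 _ lm_gt0); have := drift_slackE; lra.
Qed.

Lemma drift_slack_gain : (rm + c) / lm < (rp - c) / lp.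
Proof.
have clp := mulr_gt0 drift_slack_gt0 lp_gt0.
have clm := mulr_gt0 drift_slack_gt0 lm_gt0.
rewrite ltr_pdivrMr// mulrAC ltr_pdivlMr//; have := drift_slackE.
lra.
Qed.

End drift_slack.

Section switching_diffusion.
Context (R : realType) d (T : measurableType d) (P : probability T R).
Variables (lp lm rp rm M x : R) (bp bm : R -> R).
Variables (W : R -> T -> R) (tau : nat -> T -> R) (Z : R -> T -> bool).
Variables (X : R -> T -> R) (z : bool).
Hypotheses (lp_gt0 : 0 < lp) (lm_gt0 : 0 < lm).
Hypotheses (rm_gt0 : 0 < rm) (gain : rm / lm < rp / lp).
Hypothesis b_bounded : forall y, `|bp y| <= M /\ `|bm y| <= M.
Hypotheses (bp_ge : forall y, rp <= bp y) (bm_ge : forall y, - rm <= bm y).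
Hypothesis noise : wiener_and_sojourns P W tau z lp lm.
Hypothesis chain : chain_from_sojourns tau z Z.
Hypothesis sde : solves_sde P bp bm W Z X x.

Local Notation c := (drift_slack lp lm rp rm).
Local Notation reward := (fun k => slope (rp - c) (rm + c) (sojourn_state z k)).

Let c2_gt0 : 0 < c / 2. Proof. by rewrite divr_gt0// drift_slack_gt0. Qed.

Let gp_gt0 : 0 < rp - c. Proof. by rewrite subr_gt0 drift_slack_lt. Qed.

Let gm_gt0 : 0 < rm + c. Proof. by rewrite addr_gt0// drift_slack_gt0. Qed.

Let slack_gain : (rm + c) / lm < (rp - c) / lp.
Proof. exact: drift_slack_gain. Qed.

Let mW t : measurable_fun setT (W t).
Proof. by case: noise. Qed.

Let mtau k : measurable_fun setT (tau k).
Proof. by case: noise. Qed.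

Let mX t : measurable_fun setT (X t).
Proof. by case: sde. Qed.

Let rate_gt0 k : 0 < leave_rate lp lm (sojourn_state z k).
Proof. by rewrite /leave_rate; case: ifP. Qed.

Lemma ae_ge_wiener_add_drift (del : R) : 0 < del -> {ae P, forall w, forall m t,
  (forall k, (m <= k)%N -> del * k%:R <= reward_sum reward tau k w) ->
  jump_time tau m w <= t -> x + c * t + W t w <= X t w}.
Proof.
move=> del_gt0; case: sde => _; move: (sojourns_ae_ge0 noise); apply: filterS2.
move=> w tau_ge0 X_eq m t reward_ge mt.
have t_ge0 : 0 <= t by apply: le_trans mt; exact: jump_time_ge0.
have [_ ->] := X_eq t t_ge0; rewrite lerD2r lerD2l.
apply: (@Rintegral_ge_linear _ _ M _ _ _ tau w tau_ge0 reward
  (rp - c) c del m) => //.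
- by move=> s s_ge0; have [] := X_eq s s_ge0.
- by move=> s; rewrite /drift; case: ifP => _; have [] := b_bounded (X s w).
- move=> j; rewrite /slope; case: ifP => _ //.
  by rewrite (le_trans _ (ltW gp_gt0))// oppr_le0 ltW.
- move=> k y /chain Zy; rewrite /drift Zy /slope.
  by case: sojourn_state; rewrite ?subrK// opprD subrK.
Qed.

Let slow_reward del k := [set w | reward_sum reward tau k w <= del * k%:R].

Let measurable_slow_reward del k : measurable (slow_reward del k).
Proof.
by apply: measurable_set_bool; apply: measurable_fun_ler => //;
  exact: measurable_reward_sum.
Qed.

Let not_slow_reward del k w :
  ~ slow_reward del k w -> del * k%:R <= reward_sum reward tau k w.
Proof. by move=> /negP; rewrite -ltNge => /ltW. Qed.

Let slow_reward_tail : exists C b del : R, [/\ 0 <= C, 0 < b, 0 < del &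
  forall k, (P (slow_reward del k) <= (C * expR (- b) ^+ k)%:E)%E].
Proof.
exact: (alternating_reward_tail lp_gt0 lm_gt0 gp_gt0 gm_gt0 slack_gain mtau
  (sojourn_mutual_indep noise) (sojourn_law noise)).
Qed.

Lemma ae_linear_minorant :
  {ae P, forall w, \forall t \near +oo, x + c / 2 * t <= X t w}.
Proof.
have [C [b [del [C_ge0 b_gt0 del_gt0 slow_le]]]] := slow_reward_tail.
have r01 : 0 <= expR (- b) < 1 by rewrite expR_ge0 expR_lt1 oppr_lt0.
have W_small : {ae P, forall w, \forall t \near +oo, `|W t w| <= c / 2 * t}.
  case: (noise) => W0 cW _ _ _.
  exact: gaussian_ae_sublinear (wiener_gaussian_increments noise) c2_gt0.
have fast_rewards :=
  ae_eventually_notin_geometric (measurable_slow_reward del) C_ge0 r01 slow_le.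
move: W_small (ae_ge_wiener_add_drift del_gt0) fast_rewards.
apply: filterS3 => w W_small X_ge [m _ fast]; near=> t.
have mt : jump_time tau m w <= t.
  by near: t; apply: nbhs_pinfty_ge; exact: num_real.
have : `|W t w| <= c / 2 * t by near: t.
have := X_ge m t (fun k mk => not_slow_reward (fast k mk)) mt.
by rewrite ler_norml => ? /andP[]; lra.
Unshelve. all: by end_near. Qed.

Local Notation al := (Num.min lp lm / 4).

Let slow del t := \bigcup_(k >= (Num.truncn (al * t)).+1) slow_reward del k.
Let late t := [set w | t <= jump_time tau (Num.truncn (al * t)).+1 w].
Let noisy t := [set w | c / 2 * t <= `|W t w - W 0 w|].

Let measurable_late t : measurable (late t).
Proof.
apply: measurable_set_bool; apply: measurable_fun_ler => //.
by rewrite jump_timeE; exact: measurable_reward_sum.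
Qed.

Let measurable_noisy t : measurable (noisy t).
Proof.
apply: measurable_set_bool; apply: measurable_fun_ler => //.
by apply: measurableT_comp => //; exact: measurable_funB.
Qed.

Let below_line_le (del t : R) : 0 < del ->
  (P [set w | X t w < x + c / 2 * t]%R <=
    P (slow del t) + (P (late t) + P (noisy t)))%E.
Proof.
move=> del_gt0.
have m_slow : measurable (slow del t) by exact: bigcup_measurable.
apply: (@le_trans _ _ (P (slow del t `|` (late t `|` noisy t)))); last first.
  apply: le_trans (measureU2 P m_slow _) _; first exact: measurableU.
  by apply: leeD => //; exact: measureU2.
apply: ae_subset_le_measure.
- by apply: measurable_set_bool; exact: measurable_fun_ltr.
- by do 2 apply: measurableU => //.
move: (ae_ge_wiener_add_drift del_gt0); apply: filterS => w X_ge /= X_lt.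
apply: contrapT => /not_orP[not_slow /not_orP[/negP not_late /negP not_noisy]].
have fast k : (Num.truncn (al * t) < k)%N ->
    del * k%:R <= reward_sum reward tau k w.
  by move=> tk; apply: not_slow_reward => slow_k; apply: not_slow; exists k.
have early : jump_time tau (Num.truncn (al * t)).+1 w <= t.
  by rewrite leNgt; apply: contra not_late => /ltW.
have := X_ge _ t fast early; case: noise => W0 _ _ _ _.
by move: not_noisy; rewrite W0 subr0 -ltNge ltr_norml => /andP[]; lra.
Qed.

Lemma below_line_exponentially_small :
  exponentially_small (fun t => P [set w | X t w < x + c / 2 * t]).
Proof.
have [C [b [del [C_ge0 b_gt0 del_gt0 slow_le]]]] := slow_reward_tail.
have al_gt0 : 0 < al by rewrite divr_gt0// lt_min lp_gt0.
have al_rate k : al *+ 4 <= leave_rate lp lm (sojourn_state z k).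
  rewrite -mulr_natr divfK// /leave_rate ge_min.
  by case: ifP => _; rewrite lexx ?orbT.
apply: exponentially_small_le (fun t _ => below_line_le t del_gt0) _.
apply: exponentially_smallD; last apply: exponentially_smallD.
- exact: (bigcup_geometric_exponentially_small (measurable_slow_reward del)
    C_ge0 b_gt0 al_gt0 slow_le).
- exact: (late_jump_exponentially_small mtau rate_gt0
    (sojourn_mutual_indep noise) (sojourn_law noise) al_gt0 al_rate).
- exact: gaussian_exponentially_small (wiener_gaussian_increments noise) c2_gt0.
Qed.

Lemma low_speed_exponentially_small (eps : R) : 0 < eps -> exponentially_small
  (fun t => P [set w | (X t w - x) / t - c / 2 < - eps]).
Proof.
move=> eps_gt0; apply: exponentially_small_le below_line_exponentially_small.
move=> t t_gt0; apply: le_measure; rewrite ?inE.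
- apply: measurable_set_bool; apply: measurable_fun_ltr => //.
  apply: measurable_funB => //; apply: measurable_funM => //.
  exact: measurable_funB.
- by apply: measurable_set_bool; exact: measurable_fun_ltr.
by move=> w /= X_lt; rewrite -ltrBlDl -ltr_pdivrMr//; lra.
Qed.

End switching_diffusion.

Theorem theorem1 (R : realType) (lp lm rp rm : R) (bp bm : R -> R)
  (d : measure_display) (Omega : measurableType d) (P : probability Omega R)
  (W : R -> Omega -> R) (tau : nat -> Omega -> R) (Z : R -> Omega -> bool)
  (X : R -> Omega -> R) (x : R) (z : bool) :
  0 < lp -> 0 < lm ->
  measurable_fun setT bp -> measurable_fun setT bm ->
  (exists M : R, forall y, `|bp y| <= M /\ `|bm y| <= M) ->
  0 < rp -> 0 < rm ->
  (forall y, rp <= bp y) -> (forall y, - rm <= bm y) ->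
  rm / lm < rp / lp ->
  wiener_and_sojourns P W tau z lp lm ->
  chain_from_sojourns tau z Z ->
  solves_sde P bp bm W Z X x ->
  [/\ {ae P, forall w, (fun t => X t w) @ +oo --> +oo},
      (exists c0 : R, 0 < c0 /\
         {ae P, forall w, forall e : R, 0 < e ->
            \forall t \near +oo, c0 - e < X t w / t}) &
      (exists c0 : R, 0 < c0 /\
         forall eps : R, 0 < eps ->
           exists kappa t0 : R, 0 < kappa < 1 /\
             forall t, t0 <= t ->
               (P [set w | ((X t w - x) / t - c0 < - eps)%R] < (kappa `^ t)%:E)%E)].
Proof.
move=> lp_gt0 lm_gt0 _ _ [M b_bounded] _ rm_gt0 bp_ge bm_ge gain.
move=> noise chain sde.
pose c0 := drift_slack lp lm rp rm / 2.
have c0_gt0 : 0 < c0 by rewrite divr_gt0// drift_slack_gt0.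
have minorant := ae_linear_minorant lp_gt0 lm_gt0 rm_gt0 gain b_bounded
  bp_ge bm_ge noise chain sde.
split.
- apply: filterS minorant => w X_ge.
  exact: linear_minorant_cvgry X_ge c0_gt0.
- exists c0; split=> //; apply: filterS minorant => w X_ge e e_gt0.
  exact: linear_minorant_div_gt X_ge _ e_gt0.
- exists c0; split=> // eps eps_gt0; apply: exponentially_small_lt_powR.
  exact: (low_speed_exponentially_small lp_gt0 lm_gt0 rm_gt0 gain b_bounded
    bp_ge bm_ge noise chain sde).
Qed.
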